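(* Let $X$ be a Tychonoff space and let $\mathcal{P}\subseteq\mathcal{M}(X)$ be an algebraic set of maximal ideals of $C(X)$. Then $\mathcal{P}$-compactness is a topological property: if $X$ is $\mathcal{P}$-compact, $Y$ is a space homeomorphic with $X$, and $\mathcal{Q}\subseteq\mathcal{M}(Y)$ is the conjugate of $\mathcal{P}$ in $C(Y)$, then $Y$ is $\mathcal{Q}$-compact.
   Context: For a space $X$, $C(X)$ is the ring of real-valued continuous functions on $X$, $C^*(X)$ is its subring of bounded functions, and $\mathcal{M}(X)$ is the set of all maximal ideals of $C(X)$. An intermediate subring $A(X)$ of $C(X)$ is a subring with $C^*(X)\subseteq A(X)\subseteq C(X)$; $\mathcal{M}(A)$ is the set of all maximal ideals of $A(X)$. Isomorphism means ring isomorphism. Conjugates and algebraic sets. For a ring isomorphism $\sigma:A(X)\to B(Y)$ between intermediate subrings of $C(X)$ and $C(Y)$ and $\mathcal{E}\subseteq\mathcal{M}(A)$, put $\sigma^*(\mathcal{E})=\{\sigma(M):M\in\mathcal{E}\}\subseteq\mathcal{M}(B)$. A set $\mathcal{Q}\subseteq\mathcal{M}(B)$ is conjugate of $\mathcal{P}\subseteq\mathcal{M}(A)$ if $\sigma^*(\mathcal{P})=\mathcal{Q}$ for every isomorphism $\sigma:A(X)\to B(Y)$. A set $\mathcal{P}\subseteq\mathcal{M}(A)$ is algebraic if, for every Tychonoff space $Y$ and every intermediate subring $B(Y)$ of $C(Y)$ isomorphic with $A(X)$, there exists $\mathcal{Q}\subseteq\mathcal{M}(B)$ which is conjugate of $\mathcal{P}$.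 (When $A(X)$ and $B(Y)$ are isomorphic, the conjugate is unique.) Here these notions are used with $A(X)=C(X)$ and $B(Y)=C(Y)$. For $x\in X$ let $M_x=\{f\in C(X): f(x)=0\}$; a maximal ideal of $C(X)$ is fixed if it equals $M_x$ for some $x\in X$. For $\mathcal{P}\subseteq\mathcal{M}(X)$, $X$ is $\mathcal{P}$-compact if every $M\in\mathcal{P}$ is fixed; similarly for $Y$ and subsets of $\mathcal{M}(Y)$. *)

(* Defs.v *)
From HB Require Import structures.
From mathcomp Require Import all_boot all_order all_algebra.
From mathcomp Require Import all_classical all_reals all_analysis.

Set Implicit Arguments.
Unset Strict Implicit.
Unset Printing Implicit Defensive.

Import Order.TTheory GRing.Theory Num.Theory.
Import numFieldNormedType.Exports.

Local Open Scope classical_set_scope.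
Local Open Scope ring_scope.

(* C(X) is [continuousType X R], equipped with the ring structure inherited
   from the pointwise one on [X -> R]. As X may be empty, it is only a
   [comPzRingType] (1 = 0 is possible). *)
Section continuous_function_ring.
Context {X : topologicalType} {R : realType}.

Definition ctsfun : {pred X -> R} := mem [set f : X -> R | continuous f].

Section Sub.
Context (f : X -> R) (fP : f \in ctsfun).
#[local] HB.instance Definition _ := isContinuous.Build X R f (set_mem fP).
Definition ctsfun_Sub : continuousType X R := f.
End Sub.

Lemma ctsfun_rect (K : continuousType X R -> Type) :
  (forall f (Pf : f \in ctsfun), K (ctsfun_Sub Pf)) -> forall u, K u.
Proof.
move=> Ksub [f [[cf]]].
by have -> : cf = set_mem (@mem_set _ [set f : X -> R | continuous f] f cf)
  by []; apply: Ksub.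
Qed.

Lemma ctsfun_valP f (Pf : f \in ctsfun) : ctsfun_Sub Pf = f :> (_ -> _).
Proof. by []. Qed.

HB.instance Definition _ :=
  isSub.Build _ _ (continuousType X R) ctsfun_rect ctsfun_valP.

Lemma ctsfun_subring_closed : subring_closed ctsfun.
Proof.
split=> [|f g|f g]; rewrite !inE /=.
- by move=> x; exact: cvg_cst.
- by move=> cf cg x; exact: cvgB (cf x) (cg x).
- by move=> cf cg x; exact: cvgM (cf x) (cg x).
Qed.

HB.instance Definition _ :=
  GRing.isSubringClosed.Build _ ctsfun ctsfun_subring_closed.
HB.instance Definition _ :=
  GRing.SubChoice_isSubComPzRing.Build _ _ (continuousType X R)
    (GRing.subringClosedP _).

End continuous_function_ring.

Definition subring_of (A : comPzRingType) (S : subringClosed A) : Type :=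
  {f : A | f \in S}.

HB.instance Definition _ (A : comPzRingType) (S : subringClosed A) :=
  SubChoice.on (subring_of S).
HB.instance Definition _ (A : comPzRingType) (S : subringClosed A) :=
  GRing.SubChoice_isSubComPzRing.Build A _ (subring_of S)
    (GRing.subringClosedP _).

Section ring_notions.
Implicit Types A B C : comPzRingType.

Definition ideal A (I : set A) : Prop :=
  [/\ I 0, (forall a b, I a -> I b -> I (a + b)) &
      (forall r a, I a -> I (r * a))].

Definition maximal_ideal A (M : set A) : Prop :=
  [/\ ideal M, M <> setT &
      forall J, ideal J -> M `<=` J -> J = M \/ J = setT].

Definition max_spec A : set (set A) := [set M | maximal_ideal M].

Definition ring_isomorphic A B : Prop :=
  exists s : {rmorphism A -> B}, bijective s.

Definition ideal_image A B (s : A -> B) (E : set (set A)) : set (set B) :=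
  [set s @` M | M in E].

Definition conjugate A B (P : set (set A)) (Q : set (set B)) : Prop :=
  forall s : {rmorphism A -> B}, bijective s -> ideal_image s P = Q.

Lemma ideal_image_comp A B C (s : A -> B) (t : B -> C) (E : set (set A)) :
  ideal_image (t \o s) E = ideal_image t (ideal_image s E).
Proof.
rewrite /ideal_image image_comp; apply: eq_imagel => M _.
by rewrite /= image_comp.
Qed.

Lemma ideal_image_id A (E : set (set A)) : ideal_image id E = E.
Proof.
by rewrite /ideal_image -[RHS]image_id; apply: eq_imagel => M _; exact: image_id.
Qed.

Lemma ideal_imageK A B (s : A -> B) (t : B -> A) (E : set (set A)) :
  cancel s t -> ideal_image t (ideal_image s E) = E.
Proof.
move=> st; rewrite -ideal_image_comp -[RHS]ideal_image_id.
by congr (ideal_image _ E); apply/funext.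
Qed.

Lemma rmorphism_inverse A B (s : {rmorphism A -> B}) :
  bijective s -> exists t : {rmorphism B -> A}, cancel s t /\ cancel t s.
Proof.
move=> [t st ts].
have tz : zmod_morphism t.
  by move=> x y; rewrite -[x in LHS]ts -[y in LHS]ts -rmorphB st.
have tm : monoid_morphism t.
  split; first by rewrite -(rmorph1 s) st.
  by move=> x y; rewrite -[x in LHS]ts -[y in LHS]ts -rmorphM st.
pose m1 := GRing.isZmodMorphism.Build B A t tz.
pose m2 := GRing.isMonoidMorphism.Build B A t tm.
pose t' : {rmorphism B -> A} := HB.pack t m1 m2.
by exists t'.
Qed.

Lemma ideal_image_ideal A B (s : {rmorphism A -> B}) (I : set A) :
  bijective s -> ideal I -> ideal (s @` I).
Proof.
move=> [t _ ts] [I0 ID IM]; split.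
- by exists 0; rewrite ?rmorph0.
- move=> _ _ [a Ia <-] [b Ib <-]; exists (a + b); first exact: ID.
  by rewrite rmorphD.
- move=> r _ [a Ia <-]; exists (t r * a); first exact: IM.
  by rewrite rmorphM ts.
Qed.

Lemma ideal_image_max A B (s : {rmorphism A -> B}) (P : set (set A)) :
  bijective s -> P `<=` @max_spec A -> ideal_image s P `<=` @max_spec B.
Proof.
move=> bs PM _ [M /PM[iM MT Mmax] <-].
have [t [st ts]] := rmorphism_inverse bs.
have imK J : t @` (s @` J) = J.
  by rewrite image_comp -[RHS]image_id; apply: eq_imagel => x _; exact: st.
have imK' J : s @` (t @` J) = J.
  by rewrite image_comp -[RHS]image_id; apply: eq_imagel => x _; exact: ts.
have tT : t @` setT = setT.
  by apply/seteqP; split=> // x _; exists (s x).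
have sT : s @` setT = setT.
  by apply/seteqP; split=> // x _; exists (t x).
split; first exact: ideal_image_ideal.
  by move=> /(congr1 (image^~ t)); rewrite imK tT.
move=> J iJ sMJ; have bt : bijective t by exists s.
have [||e|e] := Mmax (t @` J).
- exact: ideal_image_ideal.
- by rewrite -(imK M); exact: image_subset.
- by left; rewrite -(imK' J) e.
- by right; rewrite -(imK' J) e.
Qed.

Lemma invariant_conjugate A B (P : set (set A)) :
  P `<=` @max_spec A -> conjugate P P -> ring_isomorphic A B ->
  exists2 Q : set (set B), Q `<=` @max_spec B & conjugate P Q.
Proof.
move=> PM Pinv [s bs]; exists (ideal_image s P); first exact: ideal_image_max.
move=> t bt; have [s' [ss' s's]] := rmorphism_inverse bs.
have bs's : bijective (s' \o t).
  by apply: bij_comp => //; exists s.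
have e : ideal_image s' (ideal_image t P) = P.
  by rewrite -ideal_image_comp; exact: (Pinv (s' \o t : {rmorphism _ -> _})).
by rewrite -[in RHS]e ideal_imageK.
Qed.

Lemma conjugate_invariant A B (P : set (set A)) (Q : set (set B)) :
  conjugate P Q -> ring_isomorphic A B -> conjugate P P.
Proof.
move=> PQ [s bs] t bt; have [s' [ss' s's]] := rmorphism_inverse bs.
have e : ideal_image s (ideal_image t P) = ideal_image s P.
  rewrite -ideal_image_comp (PQ s bs).
  exact: (PQ (s \o t : {rmorphism _ -> _}) (bij_comp bs bt)).
by rewrite -(ideal_imageK (ideal_image t P) ss') e ideal_imageK.
Qed.

End ring_notions.
Arguments max_spec A : clear implicits.

Section spaces.
Context {R : realType}.
Implicit Types X Y : topologicalType.

Definition tychonoff_space X : Prop :=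
  completely_regular_space X /\ hausdorff_space X.

Definition homeomorphic X Y : Prop :=
  exists (h : X -> Y) (k : Y -> X),
    [/\ continuous h, continuous k, cancel h k & cancel k h].

Definition intermediate_subring Y (S : subringClosed (continuousType Y R)) :=
  forall f : continuousType Y R, bounded_fun f -> f \in S.

(* The quantification is over all intermediate subrings B(Y), not only over
   C(Y); [algebraicE] below shows that this makes no difference for P a set of
   maximal ideals of C(X). *)
Definition algebraic (A : comPzRingType) (P : set (set A)) : Prop :=
  forall (Y : topologicalType) (S : subringClosed (continuousType Y R)),
    tychonoff_space Y -> intermediate_subring S ->
    ring_isomorphic A (subring_of S) ->
  exists2 Q : set (set (subring_of S)),
    Q `<=` max_spec (subring_of S) & conjugate P Q.

Definition fixed_ideal_at X (x : X) : set (continuousType X R) :=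
  [set f | f x = 0].

Definition fixed_ideal X (M : set (continuousType X R)) : Prop :=
  exists x : X, M = fixed_ideal_at x.

Definition compact_wrt X (P : set (set (continuousType X R))) : Prop :=
  forall M, P M -> fixed_ideal M.

End spaces.
Arguments algebraic R {A} P.

Section algebraicE.
Context {R : realType} (X : topologicalType).
Local Notation CX := (continuousType X R).

Let whole_subring_closed : subring_closed ([pred f : CX | true]).
Proof. by []. Qed.
HB.instance Definition _ :=
  GRing.isSubringClosed.Build CX [pred f : CX | true] whole_subring_closed.
Let whole : subringClosed CX := [pred f : CX | true].

Let whole_isomorphic : ring_isomorphic CX (subring_of whole).
Proof.
have bv : bijective (val : subring_of whole -> CX).
  by exists (fun f => Sub f isT) => // x; exact: val_inj.
by have [t [vt tv]] := @rmorphism_inverse (subring_of whole) CX val bv; exists t; exists val.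
Qed.

Lemma algebraicE (P : set (set CX)) :
  tychonoff_space X -> P `<=` max_spec CX ->
  algebraic R P <->
  (forall Y : topologicalType, tychonoff_space Y ->
     ring_isomorphic CX (continuousType Y R) ->
   exists2 Q : set (set (continuousType Y R)),
     Q `<=` max_spec (continuousType Y R) & conjugate P Q).
Proof.
move=> tX PM; split=> [aP Y tY iXY|aP Y S tY _ iXS].
- have [Q _ PQ] := aP X whole tX (fun _ _ => isT) whole_isomorphic.
  by apply: invariant_conjugate => //; exact: conjugate_invariant PQ _.
- have idiso : ring_isomorphic CX CX by exists idfun; exists idfun.
  have [Q _ PQ] := aP X tX idiso.
  by apply: invariant_conjugate => //; exact: conjugate_invariant PQ _.
Qed.

End algebraicE.

(* Main.v *)
Require Import Defs.
From HB Require Import structures.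
From mathcomp Require Import all_boot all_order all_algebra.
From mathcomp Require Import all_classical all_reals all_analysis.

Set Implicit Arguments.
Unset Strict Implicit.
Unset Printing Implicit Defensive.

Import Order.TTheory GRing.Theory Num.Theory.
Import numFieldNormedType.Exports.

Local Open Scope classical_set_scope.
Local Open Scope ring_scope.

(** Composition with the inverse [k] of a homeomorphism [h : X -> Y] is a ring isomorphism from C(X)
    onto C(Y) ([pullbackK]), and it carries the fixed ideal at [x] to the fixed ideal at [h x]
    ([pullback_fixed_ideal_at]). A conjugate [Q] is the image of [P] under every isomorphism, in
    particular under this one, so its members are images of fixed ideals and hence fixed. *)

Section pullback.
Context {R : realType}.

Lemma continuous_pullback (X Y : topologicalType) (k : Y -> X)
    (f : continuousType X R) :
  continuous k -> f \o k \in @ctsfun Y R.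
Proof.
move=> ck; rewrite inE => y.
by apply: continuous_comp; [exact: ck | exact: cts_fun].
Qed.

(** Contravariant in [k]: the map from C(X) to C(Y) comes from the inverse of the homeomorphism, not
    from [h] itself. *)
Definition pullback (X Y : topologicalType) (k : Y -> X) (ck : continuous k)
    (f : continuousType X R) : continuousType Y R :=
  ctsfun_Sub (continuous_pullback f ck).

Section pullback_rmorphism.
Context {X Y : topologicalType} {k : Y -> X} (ck : continuous k).

Lemma pullback_is_zmod_morphism : zmod_morphism (pullback ck).
Proof. by move=> f g; exact: val_inj. Qed.

Lemma pullback_is_monoid_morphism : monoid_morphism (pullback ck).
Proof. by split=> [|f g]; exact: val_inj. Qed.

HB.instance Definition _ := GRing.isZmodMorphism.Build
  (continuousType X R) (continuousType Y R) (pullback ck)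
  pullback_is_zmod_morphism.
HB.instance Definition _ := GRing.isMonoidMorphism.Build
  (continuousType X R) (continuousType Y R) (pullback ck)
  pullback_is_monoid_morphism.

End pullback_rmorphism.

Lemma pullbackK (X Y : topologicalType) (h : X -> Y) (k : Y -> X)
    (ch : continuous h) (ck : continuous k) :
  cancel h k -> cancel (pullback ck) (pullback ch).
Proof.
by move=> hk f; apply: val_inj; apply/funext => x; rewrite /= hk.
Qed.

(** The value of [f \o k] at [h x] is [f (k (h x)) = f x], so vanishing at [x] becomes vanishing at
    [h x]. *)
Lemma pullback_fixed_ideal_at (X Y : topologicalType) (h : X -> Y) (k : Y -> X)
    (ch : continuous h) (ck : continuous k) (x : X) :
  cancel h k -> cancel k h ->
  pullback ck @` fixed_ideal_at x = fixed_ideal_at (h x).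
Proof.
move=> hk kh; apply/seteqP; split=> [_ [f fx0 <-]|g ghx0].
  by rewrite /fixed_ideal_at /= hk.
(* The preimage of [g] is [g \o h]: it vanishes at [x], and [g \o h \o k = g]. *)
by exists (pullback ch g) => //; exact: pullbackK.
Qed.

End pullback.

Theorem theorem3p5 (R : realType) (X : topologicalType)
    (P : set (set (continuousType X R))) :
  tychonoff_space X ->
  P `<=` max_spec (continuousType X R) ->
  algebraic R P ->
  compact_wrt P ->
  forall (Y : topologicalType) (Q : set (set (continuousType Y R))),
    homeomorphic X Y ->
    Q `<=` max_spec (continuousType Y R) ->
    conjugate P Q ->
    compact_wrt Q.
Proof.
move=> _ _ _ Pfixed Y Q [h [k [ch ck hk kh]]] _ PQ M'.
have bk : bijective (pullback (R := R) ck).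
  by exists (pullback ch); exact: pullbackK.
(* Conjugacy, applied to this isomorphism, turns a member of [Q] into the image of some [M] in [P],
   which is the fixed ideal at some [x]. *)
rewrite -(PQ (pullback ck : {rmorphism _ -> _}) bk) => -[M /Pfixed[x ->] <-].
by exists (h x); exact: pullback_fixed_ideal_at.
Qed.
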